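(* Let $\mathcal U,\mathcal Y$ be separable Hilbert spaces, let $\theta\in\mathbf S_\kappa(\mathcal U,\mathcal Y)$, and let $\Sigma_1=(T_{\Sigma_1};\mathcal X_1,\mathcal U,\mathcal Y;\kappa)$ and $\Sigma_2=(T_{\Sigma_2};\mathcal X_2,\mathcal U,\mathcal Y;\kappa)$ be two minimal passive realizations of $\theta$. Then $\Sigma_1$ and $\Sigma_2$ are weakly similar.
   Context: All spaces are complex and separable. A Pontryagin space $\mathcal X$ is a vector space with a Hermitian indefinite inner product admitting a fundamental decomposition $\mathcal X=\mathcal X^+\oplus\mathcal X^-$ (orthogonal), where $(\mathcal X^{\pm},\pm\langle\cdot,\cdot\rangle)$ are Hilbert spaces and $\dim\mathcal X^-<\infty$; its negative index is $\dim \mathcal X^-$. Topological notions refer to the Hilbert space topology of $\mathcal X^+\oplus(-\mathcal X^-)$ (independent of the decomposition); adjoints and orthogonality are with respect to the indefinite inner products. $\mathcal L(\cdot,\cdot)$ denotes continuous linear operators. $T$ is a contraction if $\langle Tx,Tx\rangle\le\langle x,x\rangle$ for all $x$. Generalized Schur class: $\mathbf S_\kappa(\mathcal U,\mathcal Y)$ is the set of $\mathcal L(\mathcal U,\mathcal Y)$-valued functions $S$ meromorphic in the unit disc $\mathbb D$ and holomorphic near $0$ such that the kernel $K_S(w,z)=\frac{1-S(z)S(w)^*}{1-z\bar w}$ has $\kappa$ negative squares, i.e. every Hermitian matrix $(\langle K_S(w_j,w_i)f_j,f_i\rangle)_{i,j=1}^n$ with $w_i$ in the domain of holomorphy of $S$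 and $f_i\in\mathcal Y$ has at most $\kappa$ negative eigenvalues, and some such matrix has exactly $\kappa$. System: $\Sigma=(T_\Sigma;\mathcal X,\mathcal U,\mathcal Y;\kappa)=(A,B,C,D;\mathcal X,\mathcal U,\mathcal Y;\kappa)$ consists of a Pontryagin space $\mathcal X$ of negative index $\kappa$ (state space), Hilbert spaces $\mathcal U,\mathcal Y$, and $T_\Sigma=\begin{pmatrix}A&B\\C&D\end{pmatrix}\in\mathcal L(\mathcal X\oplus\mathcal U,\mathcal X\oplus\mathcal Y)$. It is passive if $T_\Sigma$ is a contraction. Its transfer function is $\theta_\Sigma(z)=D+zC(I-zA)^{-1}B$; $\Sigma$ is a realization of $\theta$ if $\theta_\Sigma=\theta$ in a neighbourhood of $0$. $\Sigma$ is minimal if both $\overline{\mathrm{span}}\{\mathrm{ran}\,A^nB:n\ge0\}=\mathcal X$ (controllable) and $\overline{\mathrm{span}}\{\mathrm{ran}\,A^{*n}C^*:n\ge0\}=\mathcal X$ (observable). Weak similarity: systems $\Sigma_j=(A_j,B_j,C_j,D_j;\mathcal X_j,\mathcal U,\mathcal Y;\kappa)$, $j=1,2$, are weakly similar if $D_1=D_2$ and there is an injective, closed, densely defined, possibly unbounded linear operator $Z:\mathcal X_1\to\mathcal X_2$ with dense range such that $ZA_1f=A_2Zf$ and $C_1f=C_2Zf$ for all $f\in\mathcal D(Z)$ (in particular $A_1f\in\mathcal D(Z)$), and $ZB_1=B_2$ (in particular $\mathrm{ran}\,B_1\subset \mathcal D(Z)$). *)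

(* Defs.v *)
From HB Require Import structures.
From mathcomp Require Import all_boot all_order all_algebra.
From mathcomp Require Import sesquilinear spectral.
From mathcomp Require Import complex.
From mathcomp Require Import all_classical all_reals all_analysis.

Set Implicit Arguments.
Unset Strict Implicit.
Unset Printing Implicit Defensive.

Import Order.TTheory GRing.Theory Num.Theory.
Import numFieldNormedType.Exports.

Local Open Scope classical_set_scope.
Local Open Scope ring_scope.

(* R[i] with its numClosedFieldType structure explicit, so that the topology of
   numClosedFieldType is found by unification.  As usual in MathComp, for
   complex numbers "a <= b" means that b - a is real and nonnegative. *)
Definition Cplx (R : realType) : numClosedFieldType := R[i].

Section Subspaces.
Context {R : realType} {X : completeNormedModType (Cplx R)}.
Implicit Types S : set X.

Definition is_subspace S : Prop :=
  S 0 /\ forall (a : Cplx R) x y, S x -> S y -> S (a *: x + y).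

Definition lspan S : set X := [set x |
  exists n (c : 'I_n -> Cplx R) (v : 'I_n -> X),
    (forall i, S (v i)) /\ x = \sum_(i < n) c i *: v i].

Definition closed_span S : set X := closure (lspan S).

Definition separable_space : Prop := exists2 S : set X, countable S & dense S.

Definition has_dim S (k : nat) : Prop :=
  exists e : {linear 'rV[Cplx R]_k -> X}, injective e /\ range e = S.

End Subspaces.
Arguments separable_space {R} X.

Record hilbertSpace (R : realType) := HilbertSpace {
  hilbert_carrier :> completeNormedModType (Cplx R) ;
  hdot : {dot hilbert_carrier for Num.conj} ;
  hilbert_norm : forall x, `|x| ^+ 2 = hdot x x ;
  hilbert_separable : separable_space hilbert_carrier }.

Record fundamental_decomposition (R : realType)
    (X : completeNormedModType (Cplx R)) (f : X -> X -> Cplx R)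
    (Xp Xm : set X) : Prop := FundamentalDecomposition {
  fund_subspace_p : is_subspace Xp ;
  fund_subspace_m : is_subspace Xm ;
  fund_direct : forall x,
    exists! p : X * X, [/\ Xp p.1, Xm p.2 & x = p.1 + p.2] ;
  fund_orthogonal : forall x y, Xp x -> Xm y -> f x y = 0 ;
  fund_pos : forall x, Xp x -> x != 0 -> 0 < f x x ;
  fund_neg : forall x, Xm x -> x != 0 -> f x x < 0 }.

(* Separable Pontryagin spaces of negative index k.  The carrier comes with the
   norm of the Hilbert space X^+ (+) (-X^-) of one of the fundamental
   decompositions; its completeness says that (X^+, f) and (X^-, -f) are Hilbert
   spaces.  The norm depends on that decomposition but its topology does not,
   and everything below uses only the topology and the form. *)
Record pontryaginSpace (R : realType) (k : nat) := PontryaginSpace {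
  pontryagin_carrier :> completeNormedModType (Cplx R) ;
  pform : {hermitian pontryagin_carrier for false & Num.conj} ;
  pontryagin_fundamental : exists Xp Xm : set pontryagin_carrier,
    [/\ fundamental_decomposition pform Xp Xm,
        has_dim Xm k &
        forall x y, Xp x -> Xm y -> `|x + y| ^+ 2 = pform x x - pform y y] ;
  pontryagin_separable : separable_space pontryagin_carrier }.

Record contLinear (R : realType) (X Y : completeNormedModType (Cplx R)) :=
  ContLinear {
    contLinear_fun :> {linear X -> Y} ;
    contLinear_cont : continuous contLinear_fun }.

(* The adjoint of T : X -> Y with respect to the forms f on X and g on Y: by the
   Riesz representation theorem the vector picked by [get] exists and is unique
   whenever T is continuous linear and f, g are the inner products of
   Hilbert or Pontryagin spaces. *)
Definition adjoint_op (R : realType) (X Y : completeNormedModType (Cplx R))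
    (f : X -> X -> Cplx R) (g : Y -> Y -> Cplx R) (T : X -> Y) (y : Y) : X :=
  get [set x | forall v, g (T v) y = f v x].

Section OperatorFunctions.
Context {R : realType} {X Y : completeNormedModType (Cplx R)}.
Implicit Types S : Cplx R -> contLinear X Y.

(* Complex differentiability in the operator norm. *)
Definition complex_differentiable S (w : Cplx R) : Prop :=
  exists S' : contLinear X Y, forall e : Cplx R, 0 < e ->
    \forall h \near (0 : Cplx R), forall x : X,
      `|S (w + h) x - S w x - h *: S' x| <= e * `|h| * `|x|.

Definition holomorphic_at S (w : Cplx R) : Prop :=
  \forall z \near w, complex_differentiable S z.

Definition meromorphic_at S (p : Cplx R) : Prop :=
  exists (m : nat) (F : Cplx R -> contLinear X Y),
    holomorphic_at F p /\
    \forall z \near p^', forall x : X, S z x = (z - p) ^- m *: F z x.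

End OperatorFunctions.

Section Schur.
Context {R : realType} {U Y : hilbertSpace R}.
Implicit Types S : Cplx R -> contLinear U Y.

Definition holomorphy_domain S : set (Cplx R) :=
  [set w | `|w| < 1 /\ holomorphic_at S w].

Definition Schur_kernel S (w z : Cplx R) (y : Y) : Y :=
  (1 - z * Num.conj w)^-1 *:
    (y - S z (adjoint_op (@hdot R U) (@hdot R Y) (S w) y)).

Definition Schur_matrix S n (w : 'I_n -> Cplx R) (y : 'I_n -> Y) :
    'M[Cplx R]_n :=
  \matrix_(i, j) hdot Y (Schur_kernel S (w j) (w i) (y j)) (y i).

(* [spectral_diag M] lists the eigenvalues of M with multiplicity when M is
   Hermitian. *)
Definition num_neg_eigenvalues n (M : 'M[Cplx R]_n) : nat :=
  #|[set i | spectral_diag M 0 i < 0]%SET|.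

Definition has_negative_squares S (k : nat) : Prop :=
  (forall n (w : 'I_n -> Cplx R) (y : 'I_n -> Y),
      (forall i, holomorphy_domain S (w i)) ->
      (num_neg_eigenvalues (Schur_matrix S w y) <= k)%N) /\
  (exists n (w : 'I_n -> Cplx R) (y : 'I_n -> Y),
      (forall i, holomorphy_domain S (w i)) /\
      num_neg_eigenvalues (Schur_matrix S w y) = k).

(* S is a total function; its values at its poles are irrelevant. *)
Definition generalized_Schur (k : nat) S : Prop :=
  [/\ forall p : Cplx R, `|p| < 1 -> meromorphic_at S p,
      holomorphic_at S 0 &
      has_negative_squares S k].

End Schur.

Record system (R : realType) (U Y : hilbertSpace R) (k : nat) := System {
  state :> pontryaginSpace R k ;
  sysA : contLinear state state ;
  sysB : contLinear U state ;
  sysC : contLinear state Y ;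
  sysD : contLinear U Y }.

Section Systems.
Context {R : realType} {U Y : hilbertSpace R} {k : nat}.
Implicit Types G : system U Y k.

Definition system_operator G (p : state G * U) : state G * Y :=
  (sysA G p.1 + sysB G p.2, sysC G p.1 + sysD G p.2).

Definition sum_form (X : pontryaginSpace R k) (H : hilbertSpace R)
    (p q : X * H) : Cplx R :=
  pform X p.1 q.1 + hdot H p.2 q.2.

Definition passive G : Prop :=
  forall p : state G * U,
    sum_form (system_operator p) (system_operator p) <= sum_form p p.

(* [pinv setT f] is the inverse of a bijective f; I - z A is bijective for z
   close to 0. *)
Definition transfer_function G (z : Cplx R) (u : U) : Y :=
  sysD G u +
  z *: sysC G (pinv setT (fun x : state G => x - z *: sysA G x) (sysB G u)).

Definition realization_of (S : Cplx R -> contLinear U Y) G : Prop :=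
  \forall z \near (0 : Cplx R), forall u, transfer_function G z u = S z u.

Definition controllable G : Prop :=
  closed_span [set x : state G | exists n u, x = iter n (sysA G) (sysB G u)]
  = setT.

Definition adjA G : state G -> state G :=
  adjoint_op (pform (state G)) (pform (state G)) (sysA G).

Definition adjC G : Y -> state G :=
  adjoint_op (pform (state G)) (@hdot R Y) (sysC G).

Definition observable G : Prop :=
  closed_span [set x : state G |
    exists n y, x = iter n (@adjA G) (@adjC G y)] = setT.

Definition minimal G : Prop := controllable G /\ observable G.

(* The unbounded operator Z is a function restricted to its domain dom; its
   values outside dom are irrelevant. *)
Record weak_similarity G1 G2 (dom : set (state G1))
    (Z : state G1 -> state G2) : Prop := WeakSimilarity {
  ws_domain : is_subspace dom ;
  ws_linear : forall (a : Cplx R) x y,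
    dom x -> dom y -> Z (a *: x + y) = a *: Z x + Z y ;
  ws_injective : forall x y, dom x -> dom y -> Z x = Z y -> x = y ;
  ws_closed :
    closed [set p : state G1 * state G2 | dom p.1 /\ p.2 = Z p.1] ;
  ws_dense_domain : dense dom ;
  ws_dense_range : dense (Z @` dom) ;
  ws_A : forall x, dom x ->
    dom (sysA G1 x) /\ Z (sysA G1 x) = sysA G2 (Z x) ;
  ws_C : forall x, dom x -> sysC G1 x = sysC G2 (Z x) ;
  ws_B : forall u, dom (sysB G1 u) /\ Z (sysB G1 u) = sysB G2 u }.

Definition weakly_similar G1 G2 : Prop :=
  sysD G1 =1 sysD G2 /\
  exists (dom : set (state G1)) (Z : state G1 -> state G2),
    weak_similarity dom Z.

End Systems.

(* Main.v *)
(* Let Z be the relation {(x, x') | C1 A1^n x = C2 A2^n x' for every n}.  It is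
   a closed subspace, and observability makes it the graph of an injective
   function.  Both realizations having the same Taylor coefficients at 0, Z
   contains every pair (A1^n B1 u, A2^n B2 u), so that controllability gives
   dense domain and range; the intertwining relations are immediate.

   What remains is that C A^n x = 0 for all n forces x = 0: x is then orthogonal
   to the vectors A*^n C* y, once the adjoints are known to exist, which is the
   Riesz theorem for the Hilbert inner product f(x, J y), J the fundamental
   symmetry. *)

Require Import Defs.
From mathcomp Require Import all_boot all_order all_algebra.
From mathcomp Require Import sesquilinear complex.
From mathcomp Require Import all_classical all_reals all_analysis.
From mathcomp Require Import ring.

Set Implicit Arguments.
Unset Strict Implicit.
Unset Printing Implicit Defensive.

Import Order.TTheory GRing.Theory Num.Theory.
Import numFieldNormedType.Exports.

Local Open Scope classical_set_scope.
Local Open Scope ring_scope.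

(** * Quadratic estimates, near-minimizers and completeness *)

(** Taking [a = - t * d^*] with [t >= 0] leaves a real quadratic in [t], whose nonnegativity yields
    the bound. It serves both Cauchy-Schwarz and the Riesz theorem. *)
Lemma real_affine_form_bound (C : numClosedFieldType) (d e p : C) :
  0 <= e -> 0 <= p ->
  (forall a, 0 <= e ^+ 2 + (a * d + (a * d)^*) + `|a| ^+ 2 * p ^+ 2) ->
  `|d| <= e * p.
Proof.
move=> e0 p0 H.
have e2 : 0 <= e ^+ 2 by rewrite exprn_ge0.
have real_t t : 0 <= t ->
    0 <= e ^+ 2 - t * `|d| ^+ 2 *+ 2 + (t * `|d| * p) ^+ 2.
  move=> t0; have := H (- t * d^*).
  have -> : - t * d^* * d = - (t * `|d| ^+ 2) by rewrite normCK; ring.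
  rewrite rmorphN /= geC0_conj ?mulr_ge0 ?exprn_ge0 //.
  rewrite normrM normrN norm_conjC (ger0_norm t0) -!exprMn.
  by congr (_ <= _); ring.
have [->|d0] := eqVneq d 0; first by rewrite normr0 mulr_ge0.
have D0 : 0 < `|d| by rewrite normr_gt0.
have := p0; rewrite le_eqVlt => /orP[/eqP p0'|pp].
  (* This [t] makes the right-hand side of [real_t] negative; the one used below
     for [p > 0] minimizes it. *)
  have := real_t ((e ^+ 2 + 1) / `|d| ^+ 2).
  rewrite -p0' mulr0 expr0n addr0 divfK ?expf_neq0 ?lt0r_neq0 //.
  have -> : e ^+ 2 - (e ^+ 2 + 1) *+ 2 = - (e ^+ 2 + 2) by ring.
  move=> /(_ _)/(le_trans _) => h.
  have : 0 <= - (e ^+ 2 + 2).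
    by apply: h => //; rewrite divr_ge0 ?addr_ge0 // exprn_ge0.
  rewrite oppr_ge0 => /(lt_le_trans (ltr_wpDl e2 (ltr0n _ 2))).
  by rewrite ltxx.
have := real_t (p ^- 2); rewrite invr_ge0 exprn_ge0 // => /(_ isT).
have -> : e ^+ 2 - p ^- 2 * `|d| ^+ 2 *+ 2 + (p ^- 2 * `|d| * p) ^+ 2 =
    e ^+ 2 - `|d| ^+ 2 / p ^+ 2.
  by field; rewrite lt0r_neq0.
rewrite subr_ge0 ler_pdivrMr ?exprn_gt0 // -exprMn.
by rewrite ler_pXn2r // nnegrE mulr_ge0.
Qed.

Lemma eq0_of_arbitrarily_small (K : numFieldType) (V : normedZmodType K)
    (x : V) (c : K) :
  0 <= c -> (forall e, 0 < e -> `|x| <= e * c) -> x = 0.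
Proof.
move=> c0 H; apply/eqP; rewrite -normr_le0; apply: contraT => x0.
have c1 : 0 < c + 1 by rewrite ltr_wpDl.
have xp : 0 < `|x|.
  by rewrite lt_neqAle normr_ge0 andbT; apply: contraNneq x0 => <-.
have := H _ (divr_gt0 xp c1).
by rewrite mulrAC ler_pdivlMr // ler_pM2l // gerDl ler10.
Qed.

(** The common lower bound forces every [F x] to have the imaginary part of [m], so only an infimum
    of real parts is involved. *)
Lemma exists_near_minimizer (R : realType) (T : Type) (x0 : T)
    (F : T -> Cplx R) (m e : Cplx R) :
  (forall x, m <= F x) -> 0 < e -> exists x, forall y, F x <= F y + e.
Proof.
move=> Fm; rewrite ltcE /= => /andP[/eqP ime ree].
have Fim x : complex.Im (F x) = complex.Im m.
  by have := Fm x; rewrite lecE => /andP[/eqP].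
have Fre x : complex.Re m <= complex.Re (F x).
  by have := Fm x; rewrite lecE => /andP[].
pose E := range (fun x => complex.Re (F x)).
have lbE : has_lbound E by exists (complex.Re m) => _ [x _ <-].
have infE : has_inf E by split => //; exists (complex.Re (F x0)), x0.
have [_ [x _ <-] /= lt_x] := inf_adherent ree infE.
exists x => y; rewrite lecE.
have -> : complex.Im (F y + e) = complex.Im (F y) + complex.Im e.
  by case: (F y) (e) => ? ? [].
have -> : complex.Re (F y + e) = complex.Re (F y) + complex.Re e.
  by case: (F y) (e) => ? ? [].
rewrite ime addr0 !Fim eqxx /=; apply: (le_trans (ltW lt_x)).
by rewrite lerD2r; apply: ge_inf => //; exists y.
Qed.

(** The sets [E e] of [e]-approximate solutions generate a Cauchy filter as [e] tends to 0, so no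
    sequence has to be chosen. *)
Lemma complete_approximation (R : realType) (X : completeNormedModType (Cplx R))
    (E : Cplx R -> set X) :
  (forall e, 0 < e -> E e !=set0) ->
  (forall e e', e <= e' -> E e `<=` E e') ->
  (forall e e' x y, 0 < e -> 0 < e' -> E e x -> E e' y ->
    `|x - y| <= e + e') ->
  exists x, forall e, 0 < e -> exists2 y, E e y & `|x - y| <= e.
Proof.
move=> E0 Emono Ecauchy.
pose F := filter_from [set e : Cplx R | 0 < e] E.
have FF : Filter F.
  apply: filter_from_filter; first by exists 1; exact: ltr01.
  move=> e e' e0 e'0; have /orP[le|le] : (e <= e') || (e' <= e).
  - by apply: real_comparable; rewrite gtr0_real.
  - by exists e => // x Ex; split => //; exact: Emono Ex.
  - by exists e' => // x Ex; split => //; exact: Emono Ex.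
have PF : ProperFilter F by exact: filter_from_proper.
have Fc : cauchy F.
  apply/cauchy_exP => e /= e0.
  have e4 : 0 < e / 4 by rewrite divr_gt0.
  have [x Ex] := E0 _ e4; exists x, (e / 4) => // y Ey.
  rewrite -ball_normE /=; apply: le_lt_trans (Ecauchy _ _ _ _ e4 e4 Ex Ey) _.
  rewrite (_ : e / 4 + e / 4 = e / 2); last by field.
  by rewrite ltr_pdivrMr // ltr_pMr // ltr1n.
have /cvg_ex[x Fx] : cvg F by exact: cauchy_cvg.
exists x => e e0.
have : F (ball x e `&` E e).
  by apply: filterI; [exact: Fx (nbhsx_ballx _ _ e0) | exists e].
move=> /filter_ex[y [xy Ey]]; exists y => //.
by move: xy; rewrite -ball_normE => /ltW.
Qed.

(** * Cauchy-Schwarz and Riesz representation *)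

(** A predicate on a bare function, so that it applies to an indefinite form twisted by a
    symmetry. *)
Record inner_product (R : realType) (X : completeNormedModType (Cplx R))
    (s : X -> X -> Cplx R) : Prop := InnerProduct {
  inner_linear : forall a x y z, s (a *: x + y) z = a * s x z + s y z ;
  inner_conj : forall x y, s x y = (s y x)^* ;
  inner_norm : forall x, s x x = `|x| ^+ 2 }.

Section InnerProduct.
Variables (R : realType) (X : completeNormedModType (Cplx R)).
Variables (s : X -> X -> Cplx R) (s_inner : inner_product s).

Lemma innerB x y z : s (x - y) z = s x z - s y z.
Proof. by rewrite addrC -scaleN1r inner_linear // mulN1r addrC. Qed.

Lemma innerBr x y z : s z (x - y) = s z x - s z y.
Proof. by rewrite 3!(inner_conj s_inner z) innerB rmorphB //=. Qed.

Lemma inner_norm_affine a x v :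
  `|a *: v + x| ^+ 2 =
  `|x| ^+ 2 + (a * s v x + (a * s v x)^*) + `|a| ^+ 2 * `|v| ^+ 2.
Proof.
have sr y : s y (a *: v + x) = a^* * s y v + s y x.
  rewrite inner_conj // inner_linear // rmorphD rmorphM /=.
  by rewrite -!(inner_conj s_inner).
rewrite -!(inner_norm s_inner) inner_linear // !sr rmorphM normCK /=.
rewrite -(inner_conj s_inner); ring.
Qed.

Lemma inner_le x v : `|s v x| <= `|x| * `|v|.
Proof.
apply: real_affine_form_bound => // a.
by rewrite -inner_norm_affine exprn_ge0.
Qed.

(* The minimizers of [|v|^2 - 2 Re (phi v)] represent [phi]; a minimizer up to
   [e^2] represents it up to an error of [e |v|] at [v], so approximate
   minimizers are automatically Cauchy. *)
Lemma riesz_representation (phi : X -> Cplx R) (M : Cplx R) :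
  (forall a x y, phi (a *: x + y) = a * phi x + phi y) -> 0 <= M ->
  (forall x, `|phi x| <= M * `|x|) ->
  exists w, forall v, phi v = s v w.
Proof.
move=> phi_lin M0 phi_le.
have phiB x y : phi (x - y) = phi x - phi y.
  by rewrite addrC -scaleN1r phi_lin mulN1r addrC.
pose F v := `|v| ^+ 2 - (phi v + (phi v)^*).
(* Completing the square: [|v|^2 - 2 M |v| = (M - |v|)^2 - M^2]. *)
have F_ge v : - M ^+ 2 <= F v.
  have le2 : phi v + (phi v)^* <= M * `|v| *+ 2.
    have [le1 _] := leif_Re_Creal (phi v).
    have -> : phi v + (phi v)^* = 'Re (phi v) *+ 2.
      by rewrite ReE -mulr_natr divfK.
    by rewrite lerMn2r /= (le_trans le1).
  rewrite /F lerBrDl (le_trans (lerD le2 (lexx _))) // -subr_ge0.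
  rewrite (_ : _ - _ = (M - `|v|) ^+ 2); last by ring.
  by rewrite real_exprn_even_ge0 // rpredB ?ger0_real.
pose E (e : Cplx R) := [set x : X | forall v, `|s v x - phi v| <= e * `|v|].
have [|||w w_lim] := @complete_approximation R X E.
- move=> e e0.
  have [x x_min] := exists_near_minimizer 0 F_ge (exprn_gt0 2 e0).
  exists x => v; apply: real_affine_form_bound => // [|a]; first exact: ltW.
  (* Comparing [x] with [a *: v + x] gives the hypothesis of [real_affine_form_bound] for
     [d = s v x - phi v]. *)
  have := x_min (a *: v + x).
  rewrite /F inner_norm_affine phi_lin -subr_ge0; congr (_ <= _).
  rewrite mulrBr rmorphB !rmorphD /=; ring.
- move=> e e' le x Ex v; apply: le_trans (Ex v) _.
  by rewrite ler_wpM2r.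
- move=> e e' x y e0 e'0 Ex Ey.
  have [->|xy] := eqVneq x y; first by rewrite subrr normr0 addr_ge0 ?ltW.
  (* Testing both errors at [x - y] bounds [|x - y| ^+ 2], whence the extra factor. *)
  rewrite -(@ler_pM2r _ `|x - y|) ?normr_gt0 ?subr_eq0 // -expr2.
  have -> : `|x - y| ^+ 2 = `|s (x - y) x - s (x - y) y|.
    by rewrite -innerBr (inner_norm s_inner) normrX normr_id.
  have -> : s (x - y) x - s (x - y) y =
      (s (x - y) x - phi (x - y)) - (s (x - y) y - phi (x - y)) by ring.
  by rewrite mulrDl (le_trans (ler_normB _ _)) // lerD.
exists w => v; apply/eqP; rewrite -subr_eq0; apply/eqP.
apply: (@eq0_of_arbitrarily_small _ _ _ (`|v| *+ 2)) => [|e e0].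
  by rewrite mulrn_wge0.
have [x Ex wx] := w_lim e e0.
rewrite distrC -[s v w](subrK (s v x)) -innerBr -addrA mulrnAr mulr2n.
rewrite (le_trans (ler_normD _ _)) // lerD //.
by rewrite (le_trans (inner_le _ _)) // ler_wpM2r.
Qed.

End InnerProduct.

(** * Bounded operators, fundamental symmetries and adjoints *)

Lemma contLinear_bounded (R : realType) (X Y : completeNormedModType (Cplx R))
    (T : contLinear X Y) :
  exists2 M : Cplx R, 0 < M & forall x, `|T x| <= M * `|x|.
Proof.
have /linear_boundedP[M [Mr TM]] : bounded_near T (nbhs (0 : X)).
  by apply: continuous_linear_bounded; exact: contLinear_cont.
have M1 : M < `|M| + 1.
  by rewrite (le_lt_trans (real_ler_norm Mr)) // ltrDl.
by exists (`|M| + 1); [rewrite ltr_wpDl | exact: TM].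
Qed.

Lemma closed_eq_norm (K : numFieldType) (T : topologicalType)
    (V : normedModType K) (f g : T -> V) :
  continuous f -> continuous g -> closed [set x | f x = g x].
Proof.
move=> fc gc.
rewrite (_ : [set x | f x = g x] = (fun x => f x - g x) @^-1` [set 0]).
  apply: preimage_closed => [x _|].
    by apply: cvgB; [exact: fc | exact: gc].
  apply: accessible_closed_set1; apply: hausdorff_accessible.
  exact: norm_hausdorff.
apply/seteqP; split => x /=; first by move=> ->; rewrite subrr.
by move/eqP; rewrite subr_eq0 => /eqP.
Qed.

(** These properties also hold for [id] on a Hilbert space, so one lemma provides the adjoints for
    both kinds of spaces. *)
Definition fundamental_symmetry (R : realType)
    (X : completeNormedModType (Cplx R)) (f : X -> X -> Cplx R)
    (J : X -> X) : Prop :=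
  [/\ inner_product (fun x y => f x (J y)), involutive J &
      forall x, `|J x| = `|x|].

Lemma hilbert_fundamental_symmetry (R : realType) (H : hilbertSpace R) :
  fundamental_symmetry (hdot H) id.
Proof.
split => //; split => [a x y z|x y|x].
- by rewrite linearDl linearZl_LR.
- by rewrite hermC expr0 mul1r.
- by rewrite hilbert_norm.
Qed.

(** [J] changes the sign of the [Xm] component. By orthogonality the twisted form is [pform] on [Xp]
    minus [pform] on [Xm], which matches the squared norm. *)
Lemma pontryagin_fundamental_symmetry (R : realType) (k : nat)
    (X : pontryaginSpace R k) :
  exists J, fundamental_symmetry (pform X) J.
Proof.
have [Xp [Xm [[sp sm dir orth _ _] _ nrm]]] := pontryagin_fundamental X.
have subN S (x : X) : is_subspace S -> S x -> S (- x).
  by move=> [S0 SP] Sx; rewrite -scaleN1r -[_ *: _]addr0; exact: SP.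
have pmP x : exists p : X * X, [/\ Xp p.1, Xm p.2 & x = p.1 + p.2].
  by have [p [? _]] := dir x; exists p.
have [pm pm_spec] := choice pmP.
have pm_uniq x y : Xp x -> Xm y -> pm (x + y) = (x, y).
  move=> px my; have [p [_ uniq]] := dir (x + y).
  by rewrite -(uniq (x, y)) ?(uniq _ (pm_spec _)).
pose J x := (pm x).1 - (pm x).2.
have JE x y : Xp x -> Xm y -> J (x + y) = x - y.
  by move=> px my; rewrite /J pm_uniq.
have orthC x y : Xp x -> Xm y -> pform X y x = 0.
  by move=> px my; rewrite hermC orth // rmorph0 mulr0.
have fJ x x' y y' : Xp x -> Xm x' -> Xp y -> Xm y' ->
    pform X (x + x') (J (y + y')) = pform X x y - pform X x' y'.
  move=> px mx' py my'; rewrite JE // linearBr !linearDl /=.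
  by rewrite (orth x y') // (orthC y x') // addr0 add0r.
exists J; split; first split => [a x y z|x y|x].
- by rewrite linearDl linearZl_LR.
- have [px mx' ->] := pm_spec x; have [py my' ->] := pm_spec y.
  by rewrite !fJ // rmorphB [in LHS]hermC [in X in _ - X]hermC !expr0 !mul1r.
- by have [px mx' ->] := pm_spec x; rewrite fJ // -nrm.
- move=> x; have [px mx' ->] := pm_spec x.
  by rewrite JE // JE ?opprK //; exact: subN.
move=> x; have [px mx' ->] := pm_spec x.
apply/eqP; rewrite -(@eqrXn2 _ 2) // JE // !nrm //; last exact: subN.
by rewrite linearNl linearNr opprK.
Qed.

Section Adjoint.
Variables (R : realType) (X Y : completeNormedModType (Cplx R)).
Variables (f : X -> X -> Cplx R) (J : X -> X) (fJ : fundamental_symmetry f J).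
Variables (g : Y -> Y -> Cplx R) (L : Y -> Y) (gL : fundamental_symmetry g L).

Lemma form_le x y : `|f x y| <= `|x| * `|y|.
Proof.
have [inner JJ Jn] := fJ.
by rewrite -[y in f x y]JJ (le_trans (inner_le inner _ _)) // Jn mulrC.
Qed.

Lemma formP a x y z : f (a *: x + y) z = a * f x z + f y z.
Proof. by have [inner JJ _] := fJ; rewrite -[z]JJ (inner_linear inner). Qed.

End Adjoint.

(** Riesz represents [g (T v) y] as [f v (J w)]; thus [J w] witnesses that [get] picks an actual
    adjoint vector. *)
Lemma adjoint_opP (R : realType) (X Y : completeNormedModType (Cplx R))
    (f : X -> X -> Cplx R) (J : X -> X) (g : Y -> Y -> Cplx R) (L : Y -> Y)
    (T : contLinear X Y) v y :
  fundamental_symmetry f J -> fundamental_symmetry g L ->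
  g (T v) y = f v (adjoint_op f g T y).
Proof.
move=> fJ gL; have [inner _ _] := fJ.
have [M M0 TM] := contLinear_bounded T.
have [||x|w Tw] :=
    @riesz_representation R X _ inner (fun v => g (T v) y) (M * `|y|).
- by move=> a x z; rewrite linearP (formP gL).
- by rewrite mulr_ge0 // ltW.
- rewrite (le_trans (form_le gL _ _)) // mulrAC.
  by rewrite ler_wpM2r.
have := @getPex _ [set x | forall v, g (T v) y = f v x]; apply.
by exists (J w).
Qed.

(** * Observability as a uniqueness property *)

Section Observability.
Variables (R : realType) (U Y : hilbertSpace R) (k : nat) (G : system U Y k).

Lemma pform_iter_adjA n (x z : state G) :
  pform (state G) x (iter n (@adjA _ _ _ _ G) z) =
  pform (state G) (iter n (sysA G) x) z.
Proof.
have [J fJ] := pontryagin_fundamental_symmetry (state G).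
elim: n x => [//|n IHn] x.
by rewrite iterS -(adjoint_opP (sysA G) _ _ fJ fJ) IHn -iterSr.
Qed.

(** Orthogonality to [x] passes to the closed span because the form is bounded; then [|x|^2], the
    form at [x] and [J x], vanishes. *)
Lemma observable_eq0 (x : state G) : observable G ->
  (forall n, sysC G (iter n (sysA G) x) = 0) -> x = 0.
Proof.
move=> obs Cx.
have [J fJ] := pontryagin_fundamental_symmetry (state G).
have [inner _ _] := fJ.
suff fx z : pform (state G) x z = 0.
  by apply/eqP; rewrite -normr_eq0 -sqrf_eq0 -(inner_norm inner) fx.
have : closed_span [set x : state G |
    exists n y, x = iter n (@adjA _ _ _ _ G) (@adjC _ _ _ _ G y)] z.
  by rewrite obs.
rewrite /closed_span /closure => /= cl_z.
apply: (@eq0_of_arbitrarily_small _ _ _ `|x|) => // e e0.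
have [_ [[n [c [v [vE ->]]]]]] := cl_z _ (nbhsx_ballx z e e0).
rewrite -ball_normE /= => ze.
have fx0 : pform (state G) x (\sum_(i < n) c i *: v i) = 0.
  rewrite linear_sumr big1 // => i _; have [m [y ->]] := vE i.
  rewrite linearZr_LR /= pform_iter_adjA.
  rewrite -(adjoint_opP (sysC G) _ _ fJ (hilbert_fundamental_symmetry Y)).
  by rewrite Cx linear0l mulr0.
rewrite -[pform _ x z]subr0 -fx0 -linearBr mulrC.
by rewrite (le_trans (form_le fJ _ _)) // ler_wpM2l // ltW.
Qed.

End Observability.

(** * The resolvent near 0 *)

Lemma exists_geometric_lt (R : realType) (c e : Cplx R) :
  0 <= c -> 0 < e -> exists n, c / 2 ^+ n <= e.
Proof.
move=> c0 e0; have ce0 : 0 <= c / e by rewrite divr_ge0 // ltW.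
have /archi_boundP : 0 <= complex.Re (c / e).
  by move: ce0; rewrite lecE => /andP[].
set n := Num.Def.archi_bound _ => lt_n; exists n.
have le_n : c / e <= 2 ^+ n.
  rewrite -(RRe_real (ger0_real ce0)).
  rewrite (_ : 2 ^+ n = (2 ^+ n)%:C%C :> Cplx R); last first.
    by rewrite rmorphXn rmorph_nat.
  rewrite lecR (le_trans (ltW lt_n)) // -natrX ler_nat.
  by rewrite ltnW // ltn_expl.
by rewrite ler_pdivrMr ?exprn_gt0 // mulrC -ler_pdivrMr.
Qed.

Section Resolvent.
Variables (R : realType) (X : completeNormedModType (Cplx R)).
Variables (A : contLinear X X).

(** [z *: A x] has at most half the norm of [x]. The bound gives both the Cauchy estimate for
    approximate solutions and the size of the solution. *)
Lemma norm_le_resolvent (M z : Cplx R) x :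
  (forall y, `|A y| <= M * `|y|) -> `|z| * M <= 2^-1 ->
  `|x| <= `|x - z *: A x| * 2.
Proof.
move=> AM zM.
have zA : `|z *: A x| <= `|x| / 2.
  by rewrite normrZ (le_trans (ler_wpM2l _ (AM x))) // mulrA mulrC ler_wpM2l.
have := ler_normD (x - z *: A x) (z *: A x).
rewrite subrK => /le_trans/(_ (lerD (lexx _) zA)).
rewrite -lerBlDr (_ : `|x| - `|x| / 2 = `|x| / 2); last by field.
by rewrite ler_pdivrMr.
Qed.

(** Neumann iteration, with [complete_approximation] applied to the points of small residual. *)
Lemma resolvent_surjective (M z : Cplx R) b :
  0 <= M -> (forall y, `|A y| <= M * `|y|) -> `|z| * M <= 2^-1 ->
  exists x, x - z *: A x = b.
Proof.
move=> M0 AM zM.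
pose res x := x - z *: A x - b.
have resB x y : res x - res y = (x - y) - z *: A (x - y).
  rewrite /res (raddfB A) /= scalerBr !opprB addrA subrK.
  by rewrite addrACA [RHS]addrACA [- y - _]addrC.
(* The factor 2 is that of [norm_le_resolvent], which turns residuals into distances. *)
have [|||w w_lim] := @complete_approximation R X
  (fun e => [set x | `|res x| * 2 <= e]).
- move=> e e0.
  have [n ne] := exists_geometric_lt (mulr_ge0 (normr_ge0 b) (ler0n _ 2)) e0.
  (* Each iteration multiplies the residual by [z A], hence halves it. *)
  exists (iter n (fun x => b + z *: A x) 0) => /=; apply: le_trans ne.
  rewrite [X in _ <= X]mulrAC ler_pM2r //.
  elim: n => [|n IHn].
    by rewrite /res /= linear0 scaler0 subrr sub0r normrN expr0 divr1.
  rewrite iterS; move: (iter n _ _) IHn => x IHn.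
  have -> : res (b + z *: A x) = z *: A (res x).
    rewrite /res !(raddfB A) (raddfD A) /= !scalerBr scalerDr.
    by rewrite addrAC [b + _]addrC addrK opprD addrA addrAC.
  rewrite normrZ exprS invfM mulrCA.
  rewrite (le_trans (ler_wpM2l _ (AM _))) //.
  by rewrite [X in X <= _]mulrA ler_pM // mulr_ge0.
- by move=> e e' le x /= /le_trans; exact.
- move=> e e' x y _ _ /= xe ye; apply: le_trans (norm_le_resolvent _ AM zM) _.
  rewrite -resB (le_trans (ler_wpM2r _ (ler_normB _ _))) // mulrDl lerD //.
exists w; apply/eqP; rewrite -subr_eq0; apply/eqP.
apply: (@eq0_of_arbitrarily_small _ _ _ 3) => // e e0.
have [y /= ye wy] := w_lim e e0.
rewrite -[X in `|X|](subrK (res y)) resB.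
(* The first bracket bounds [res w - res y], the second one, generously, [res y]. *)
have -> : e * 3 = (e + e / 2) + (e / 2 + e) by field.
have e2 : 0 <= e / 2 by rewrite divr_ge0 // ltW.
have ye2 : `|res y| <= e / 2 by rewrite ler_pdivlMr.
rewrite (le_trans (ler_normD _ _)) // lerD //; last first.
  by rewrite (le_trans ye2) // lerDl ltW.
rewrite (le_trans (ler_normB _ _)) // lerD // normrZ.
rewrite (le_trans (ler_wpM2l _ (AM _))) // mulrA [e / 2]mulrC.
by rewrite ler_pM // mulr_ge0.
Qed.

End Resolvent.

(** The bound on [x] is uniform in [z], which controls remainders as [z] tends to 0. *)
Lemma resolvent_near0 (R : realType) (X : completeNormedModType (Cplx R))
    (A : contLinear X X) :
  exists2 d : Cplx R, 0 < d & forall z b, `|z| <= d ->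
    let x := pinv setT (fun x => x - z *: A x) b in
    x = b + z *: A x /\ `|x| <= `|b| * 2.
Proof.
have [M M0 AM] := contLinear_bounded A.
exists (2^-1 / M); first by rewrite divr_gt0.
move=> z b zd; have zM : `|z| * M <= 2^-1 by rewrite -ler_pdivlMr.
set x := pinv _ _ _ => /=.
have xE : x - z *: A x = b.
  apply: (@pinvK _ _ _ setT (fun x => x - z *: A x)); rewrite inE.
  by have [y <-] := resolvent_surjective b (ltW M0) AM zM; exists y.
split; first by rewrite -[in X in _ = X + _]xE subrK.
by rewrite -[in X in _ <= X]xE; exact: norm_le_resolvent AM zM.
Qed.

Definition contLinear_comp (R : realType)
    (X Y Z : completeNormedModType (Cplx R))
    (T : contLinear Y Z) (S : contLinear X Y) : contLinear X Z :=
  ContLinear (contLinear_fun := (T \o S : {linear X -> Z}))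
    (fun x => continuous_comp (@contLinear_cont _ _ _ S x)
                              (@contLinear_cont _ _ _ T (S x))).

(** * Markov parameters *)

Section Observation.
Variables (R : realType) (U Y : hilbertSpace R) (k : nat).
Implicit Type G : system U Y k.

(** The operator [C A^n] bundled with its continuity. [A] is applied first, so that order [n.+1] at
    [x] converts to order [n] at [sysA G x]. *)
Fixpoint observation G n : contLinear (state G) Y :=
  if n is n'.+1 then contLinear_comp (observation G n') (sysA G) else sysC G.

Lemma observationE G n x : observation G n x = sysC G (iter n (sysA G) x).
Proof. by elim: n x => [//|n IHn] x; rewrite iterSr -IHn. Qed.

(** Finite Neumann expansion of [C (I - z A)^-1 b] with exact remainder, in place of a power
    series. *)
Lemma observation_resolvent G n z b (x : state G) : x = b + z *: sysA G x ->
  sysC G x =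
  \sum_(j < n) z ^+ j *: observation G j b + z ^+ n *: observation G n x.
Proof.
move=> xE; elim: n => [|n ->]; first by rewrite big_ord0 add0r expr0 scale1r.
rewrite big_ord_recr /= -addrA; congr (_ + _).
by rewrite [in LHS]xE linearD linearZ /= scalerDr scalerA -exprSr.
Qed.

Lemma transfer_function_sysD theta G :
  realization_of theta G -> sysD G =1 theta 0.
Proof.
move=> /nbhs_singleton H u; rewrite -H /transfer_function scale0r addr0 //.
Qed.

(* Induction on [n]: after cancelling the lower order terms and [z ^+ n.+1], the
   resolvent equation [x = b + z A x] shows that the two [n]-th coefficients
   differ by [O(z)]. *)
Lemma markov_parameters_eq theta G1 G2 n u :
  realization_of theta G1 -> realization_of theta G2 ->
  observation G1 n (sysB G1 u) = observation G2 n (sysB G2 u).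
Proof.
move=> r1 r2; elim/ltn_ind: n => n IHn.
have [d1 d10 res1] := resolvent_near0 (sysA G1).
have [d2 d20 res2] := resolvent_near0 (sysA G2).
have [M1 M10 O1] := contLinear_bounded (observation G1 n.+1).
have [M2 M20 O2] := contLinear_bounded (observation G2 n.+1).
set b1 := sysB G1 u in IHn *; set b2 := sysB G2 u in IHn *.
apply/eqP; rewrite -subr_eq0; apply/eqP.
(* [M1] and [M2] bound the operators in the remainders; the factors 2 come from the resolvent
   bounds. *)
apply: (@eq0_of_arbitrarily_small _ _ _ (M1 * (`|b1| * 2) + M2 * (`|b2| * 2))).
  by apply: addr_ge0; apply: mulr_ge0; rewrite ?mulr_ge0 // ltW.
move=> e e0.
have [z [[zn0 ze zd1 zd2] [t1 t2]]] : exists z : Cplx R, [/\ z != 0,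
    `|z| <= e, `|z| <= d1 & `|z| <= d2] /\
    transfer_function G1 z u = theta z u /\
    transfer_function G2 z u = theta z u.
  (* The punctured filter supplies [z != 0], so that powers of [z] can be cancelled. *)
  have : (0 : Cplx R)^' [set z |
      [/\ z != 0, `|z| <= e, `|z| <= d1 & `|z| <= d2] /\
      transfer_function G1 z u = theta z u /\
      transfer_function G2 z u = theta z u].
    near=> z; split; [split|split].
    - by near: z; exact: nbhs_dnbhs_neq.
    - by near: z; exact: dnbhs0_le.
    - by near: z; exact: dnbhs0_le.
    - by near: z; exact: dnbhs0_le.
    - by near: z; apply: nbhs_dnbhs; apply: filterS r1.
    - by near: z; apply: nbhs_dnbhs; apply: filterS r2.
  by move=> /filter_ex.
have [x1E x1b] := res1 z b1 zd1; have [x2E x2b] := res2 z b2 zd2.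
have := t1; rewrite -t2 /transfer_function -/b1 -/b2.
move: (pinv _ _ b1) (pinv _ _ b2) x1E x1b x2E x2b => x1 x2 x1E x1b x2E x2b.
rewrite (transfer_function_sysD r1) (transfer_function_sysD r2).
move/addrI/(scalerI zn0).
rewrite (observation_resolvent n x1E) (observation_resolvent n x2E).
rewrite (eq_bigr (fun j : 'I_n => z ^+ j *: observation G2 j b2)); last first.
  by move=> j _; rewrite IHn.
move/addrI/(scalerI (expf_neq0 n zn0)).
rewrite [in LHS]x1E [in RHS]x2E !linearD !linearZ /=.
move=> eqz.
have -> : observation G1 n b1 - observation G2 n b2 =
    z *: (observation G2 n.+1 x2 - observation G1 n.+1 x1).
  apply/eqP; rewrite scalerBr subr_eq addrAC eq_sym subr_eq eq_sym.
  by rewrite [X in _ == X]addrC; apply/eqP.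
rewrite normrZ ler_pM // (le_trans (ler_normB _ _)) // addrC lerD //.
  by rewrite (le_trans (O1 _)) // ler_wpM2l // ltW.
by rewrite (le_trans (O2 _)) // ler_wpM2l // ltW.
Unshelve. all: end_near.
Qed.

End Observation.

(** * Dense subspaces and the relation of equal observations *)

Lemma lspan_sub_subspace (R : realType) (X : completeNormedModType (Cplx R))
    (S D : set X) :
  is_subspace D -> S `<=` D -> lspan S `<=` D.
Proof.
move=> [D0 DP] SD _ [n [c [v [vS ->]]]].
elim/big_ind: _ => [//|x y Dx Dy|i _].
  by rewrite -[x]scale1r; exact: DP.
by rewrite -[_ *: _]addr0; apply: DP => //; exact/SD/vS.
Qed.

Lemma subspace_dense (R : realType) (X : completeNormedModType (Cplx R))
    (S D : set X) :
  is_subspace D -> S `<=` D -> closed_span S = setT -> dense D.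
Proof.
move=> subD SD spanS O [p Op] openO.
have : closed_span S p by rewrite spanS.
move=> /(_ O (open_nbhs_nbhs (conj openO Op)))[y []].
move=> /(lspan_sub_subspace subD SD).
by exists y.
Qed.

Section SameObservations.
Variables (R : realType) (U Y : hilbertSpace R) (k : nat).
Implicit Type G : system U Y k.

(** Symmetric in the two systems: exchanging them turns facts about [Z] into facts about its
    inverse. *)
Definition same_observations G1 G2 (x : state G1) (x' : state G2) : Prop :=
  forall n, observation G1 n x = observation G2 n x'.

Lemma same_observations_subspace G1 G2 :
  is_subspace [set x : state G1 | exists x' : state G2, same_observations x x'].
Proof.
split; first by exists 0 => n; rewrite !linear0.
move=> a x y [x' xx'] [y' yy']; exists (a *: x' + y') => n.
by rewrite !linearP xx' yy'.
Qed.

Lemma same_observations_inj G1 G2 (x : state G1) (x' y' : state G2) :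
  observable G2 -> same_observations x x' -> same_observations x y' -> x' = y'.
Proof.
move=> obs xx' xy'; apply/eqP; rewrite -subr_eq0; apply/eqP.
apply: observable_eq0 => // n.
by rewrite -observationE linearB /= -xx' -xy' subrr.
Qed.

Lemma same_observations_sysA G1 G2 (x : state G1) (x' : state G2) :
  same_observations x x' -> same_observations (sysA G1 x) (sysA G2 x').
Proof. by move=> xx' n; exact: (xx' n.+1). Qed.

Lemma same_observations_dense theta G1 G2 :
  realization_of theta G1 -> realization_of theta G2 -> controllable G1 ->
  dense [set x : state G1 | exists x' : state G2, same_observations x x'].
Proof.
move=> r1 r2; apply: subspace_dense; first exact: same_observations_subspace.
move=> _ [n [u ->]]; exists (iter n (sysA G2) (sysB G2 u)).
(* Equality of the Markov parameters starts the induction. *)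
elim: n => [|n IHn]; last exact: same_observations_sysA.
by move=> n; exact: markov_parameters_eq r1 r2.
Qed.

(** An intersection of equalizers of continuous maps into [Y]. *)
Lemma same_observations_closed G1 G2 :
  closed [set p : state G1 * state G2 | same_observations p.1 p.2].
Proof.
rewrite (_ : [set _ | _] = \bigcap_n [set p : state G1 * state G2 |
    observation G1 n p.1 = observation G2 n p.2]); last first.
  by apply/seteqP; split => [p pp n _|p pp n]; exact: pp.
apply: closed_bigI => n _; apply: closed_eq_norm => p.
- by apply: continuous_comp; [exact: cvg_fst | exact: contLinear_cont].
- by apply: continuous_comp; [exact: cvg_snd | exact: contLinear_cont].
Qed.

End SameObservations.

Theorem theorem2p5 (R : realType) (U Y : hilbertSpace R) (k : nat)
    (theta : Cplx R -> contLinear U Y) (htheta : generalized_Schur k theta)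
    (G1 G2 : system U Y k)
    (real1 : realization_of theta G1) (real2 : realization_of theta G2)
    (min1 : minimal G1) (min2 : minimal G2)
    (passive1 : passive G1) (passive2 : passive G2) :
  weakly_similar G1 G2.
Proof.
have [[con1 obs1] [con2 obs2]] := (min1, min2).
split=> [u|].
  by rewrite (transfer_function_sysD real1) (transfer_function_sysD real2).
pose dom := [set x : state G1 | exists x' : state G2, same_observations x x'].
(* On [dom], the vector picked is unique by observability of [G2]; elsewhere it is a default
   value. *)
pose Z (x : state G1) : state G2 := get [set x' | same_observations x x'].
have ZP x : dom x -> same_observations x (Z x).
  move=> domx.
  exact: (@getPex _ [set x' : state G2 | same_observations x x']).
have ZE x x' : same_observations x x' -> dom x /\ Z x = x'.
  move=> xx'; have domx : dom x by exists x'.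
  by split=> //; exact: same_observations_inj obs2 (ZP _ domx) xx'.
exists dom, Z; split.
- exact: same_observations_subspace.
- move=> a x y /ZP xZ /ZP yZ; apply: (ZE _ _ _).2 => n.
  by rewrite !linearP xZ yZ.
- move=> x y /ZP xZ /ZP yZ xy.
  (* Injectivity of [Z] is uniqueness for the exchanged systems. *)
  apply: (@same_observations_inj _ _ _ _ G2 G1 (Z x)).
  + exact: obs1.
  + by move=> n; rewrite xZ.
  + by move=> n; rewrite yZ xy.
- rewrite (_ : [set _ | _] = [set p | same_observations p.1 p.2]).
    exact: same_observations_closed.
  apply/seteqP; split => -[x x'] /=; first by move=> [domx ->]; exact: ZP.
  by move=> /ZE[domx ->].
- exact: same_observations_dense real1 real2 con1.
(* The range of [Z] is the domain of the inverse relation, hence dense by controllability of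
   [G2]. *)
- rewrite (_ : Z @` dom =
      [set x' | exists x : state G1, same_observations x' x]).
    exact: same_observations_dense real2 real1 con2.
  apply/seteqP; split => [_ [x /ZP xZ <-]|x' [x x'x]] /=.
    by exists x => n; rewrite xZ.
  by have [domx <-] := ZE x x' (fun n => esym (x'x n)); exists x.
- by move=> x /ZP xZ; apply: ZE; exact: same_observations_sysA.
- by move=> x /ZP xZ; exact: (xZ 0).
- by move=> u; apply: ZE => n; exact: markov_parameters_eq real1 real2.
Qed.
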